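(* For every $c>0$ and $\varepsilon>0$ there is a $D>0$ such that the following holds for all large enough $n$. Let $T$ be a triangle and let $S$ be a set of $n$ points in the plane such that $S$ contains at least $cn^2$ triangles similar to $T$. Then there is a quadrangle $Q$ and a set $U$ of at most $Dn$ points in the plane such that $S\subset U$ and $U$ contains at least $(c-\varepsilon)n^2$ quadrangles similar to $Q$.
   Context: Triangles are non-degenerate and identified with their vertex sets; a quadrangle is likewise identified with its four (distinct) vertices. A point set contains a triangle (or quadrangle) if it contains all of its vertices. Similarity allows both orientations. ''Large enough $n$'' means $n\ge n_0(c,\varepsilon)$. *)

(* Defs.v *)
From HB Require Import structures.
From mathcomp Require Import all_boot all_order all_algebra.
From mathcomp Require Import finmap.
From mathcomp Require Import boolp reals.

Set Implicit Arguments.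
Unset Strict Implicit.
Unset Printing Implicit Defensive.

Import Order.TTheory GRing.Theory Num.Theory.

Local Open Scope fset_scope.
Local Open Scope ring_scope.

Notation plane R := 'rV[R]_2.

(* The norm [`|x - y|] that MathComp-Analysis puts on matrices is the sup
   norm, hence the explicit formula. *)
Definition edist (R : realType) (x y : plane R) : R :=
  Num.sqrt (\sum_(i < 2) (x 0 i - y 0 i) ^+ 2).

(* Orientation-reversing maps are included. *)
Definition similarity (R : realType) (f : plane R -> plane R) : Prop :=
  exists2 r : R, 0 < r & forall x y, edist (f x) (f y) = r * edist x y.

Definition fset_similar (R : realType) (A B : {fset plane R}) : Prop :=
  exists2 f : plane R -> plane R, similarity f & B = [fset f x | x in A].

Definition collinear (R : realType) (A : {fset plane R}) : Prop :=
  exists p v : plane R, v <> 0 /\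
    forall x, x \in A -> exists t : R, x = p + t *: v.

Definition triangle (R : realType) (A : {fset plane R}) : Prop :=
  #|` A| = 3%N /\ ~ collinear A.

(* Only distinctness of the four vertices is required. *)
Definition quadrangle (R : realType) (A : {fset plane R}) : Prop :=
  #|` A| = 4%N.

(* Similarities are injective and preserve collinearity, so when [F] is a
   triangle (quadrangle) every member of [copies F S] is one too. *)
Definition copies (R : realType) (F S : {fset plane R}) :
    {fset {fset plane R}} :=
  [fset A in fpowerset S | `[< fset_similar F A >]].

(* Main.v *)
Require Import Defs.
From HB Require Import structures.
From mathcomp Require Import all_boot all_order all_algebra.
From mathcomp Require Import finmap.
From mathcomp Require Import boolp reals.
From mathcomp Require Import complex.
From mathcomp Require Import zify ring lra.

(** Identify the plane with the complex numbers and let [T] have vertices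
    [a], [b], [z], with [a] and [b] the ends of a shortest side. With
    [zeta = (z - a) / (b - a)], the copies of [T] of a given orientation are
    the triples [(u, v, (1 - xi) * u + xi * v)] where [xi] is [zeta] or its
    conjugate. Add to [T] the vertex
    [w = ((1 - zeta) * a - zeta * b) / (1 - 2 * zeta)], the harmonic conjugate
    of [z] with respect to [a] and [b]. Each copy of [T] in [S] extends to a
    copy of [Q = T + w], and [U] is [S] together with fourth vertices of almost
    all copies.

    These are few. For a copy of [T], the sum of [x = (1 - xi) * u] and
    [y = xi * v] lies in [S], and its fourth vertex is a fixed multiple of
    [x - y]. This is the situation of the Balog-Szemeredi-Gowers theorem: from
    sums along a dense graph, one wants to control differences. All but a small
    proportion of the edges have their difference represented at least a constant
    times [n ^ 3] times as [x1 - y2 + y3 - y4] with arguments from sets of size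
    [n]
    ([most_triples_have_many_detours]), so that there are only [O(n)] such
    differences ([most_sums_have_few_differences]). The proportion lost can be
    made as small as desired at the expense of the constant, which is how
    [c - eps] arises.

    It remains to see that different copies of [T] do not extend to the same
    copy of [Q]. This holds because [T] is the only triangle similar to [T] in
    [Q] ([unique_copy_in_quadrangle]). The four points lie on a circle, so a
    second triangle would be congruent to [T]; comparing sides excludes this
    because the side from [a] to [b] is shortest. *)

Set Implicit Arguments.
Unset Strict Implicit.
Unset Printing Implicit Defensive.

Import Order.TTheory GRing.Theory Num.Theory.

(** * Dense linear triple systems *)

(** Double counting: the elements of [E] over a fixed value [i] of [p] embed
    through [r] in [N i], which has fewer than [n / q] elements. *)
Lemma card_low_degree (J I : finType) (E : {set J}) (p r : J -> I)
    (N : I -> {set I}) (q n : nat) :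
  {in E &, injective (fun t => (p t, r t))} ->
  (forall t, t \in E -> (r t \in N (p t)) && (q * #|N (p t)| < n)) ->
  q * #|E| <= n * #|I|.
Proof.
move=> inj_pr lowN.
have fibre_le i : q * #|[set t in E | p t == i]| <= n.
  have [->|[t0]] := set_0Vmem [set t in E | p t == i]; first by rewrite cards0 muln0.
  rewrite inE => /andP[/lowN/andP[_ lt0] /eqP pt0]; rewrite pt0 in lt0.
  apply: leq_trans (ltnW lt0); rewrite leq_mul2l; apply/orP; right.
  rewrite -(@card_in_imset _ _ r); last first.
    move=> t t'; rewrite !inE => /andP[tE /eqP pt] /andP[tE' /eqP pt'] rtt'.
    by apply: inj_pr => //=; rewrite pt pt' rtt'.
  apply: subset_leq_card; apply/subsetP => _ /imsetP[t + ->].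
  by rewrite inE => /andP[/lowN/andP[+ _] /eqP <-].
have -> : #|E| = \sum_i #|[set t in E | p t == i]|.
  rewrite -sum1_card (partition_big p predT) //=.
  apply: eq_bigr => i _; rewrite -sum1_card.
  by apply: eq_bigl => t; rewrite inE.
rewrite big_distrr /= mulnC -sum_nat_const.
exact: leq_sum.
Qed.

(** Any two entries of a triple of [H] determine the third. *)
Definition linear_triples (I : finType) (H : {set I * I * I}) : Prop :=
  [/\ {in H &, injective (fun t => t.1)},
      {in H &, injective (fun t => (t.1.1, t.2))} &
      {in H &, injective (fun t => (t.1.2, t.2))}].

Definition adj13 (I : finType) (H : {set I * I * I}) (i k : I) : bool :=
  [exists j, (i, j, k) \in H].
Definition adj23 (I : finType) (H : {set I * I * I}) (j k : I) : bool :=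
  [exists i, (i, j, k) \in H].

(** The walks [j - k1 - i' - k2 - i] between the first two entries of a triple
    [(i, j, k)], encoded as [u = (i', k1, k2)]. *)
Definition detours (I : finType) (H : {set I * I * I}) (t : I * I * I) :
    {set I * I * I} :=
  [set u | [&& adj13 H u.1.1 u.1.2, adj23 H t.1.2 u.1.2,
               adj13 H u.1.1 u.2 & adj13 H t.1.1 u.2]].

Lemma card_detours (I : finType) (H : {set I * I * I}) (t : I * I * I) :
  #|detours H t| =
  \sum_i #|[set k | adj13 H i k && adj23 H t.1.2 k]|
         * #|[set k | adj13 H i k && adj13 H t.1.1 k]|.
Proof.
rewrite -sum1_card (partition_big (fun u : I * I * I => u.1.1) predT) //=.
apply: eq_bigr => i _; rewrite -cardsX.
rewrite -[RHS](card_imset _ (_ : injective (fun u : I * I => (i, u.1, u.2)))); last first.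
  by move=> [k1 k2] [k1' k2'] /= [-> ->].
rewrite sum1dep_card; apply: eq_card => -[[i' k1] k2].
rewrite !inE /=; apply/andP/imsetP.
  move=> [/and4P[h1 h2 h3 h4] /eqP ei]; exists (k1, k2); last by rewrite /= ei.
  by rewrite !inE /= -ei h1 h2 h3 h4.
move=> [[k1' k2']]; rewrite !inE /= => h [-> -> ->].
by case/andP: h => /andP[-> ->] /andP[-> ->].
Qed.

(** A positive proportion of all [u] are detours of [(i, j, k)] as soon as a
    positive proportion of all [i'] are adjacent to [k] and share a positive
    proportion of all possible neighbours with [i], and also with [j]. The triples
    that fail this are few, since they contain a vertex of low degree: [B1]
    collects those in which [k] has fewer than [n / m] neighbours. For fixed
    [i'], restrict to the triples with third entry in the neighbourhood of
    [i']; there, [Bx i'] and [By i'] collect the triples whose first or second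
    entry has fewer than [n / q] neighbours. Averaged over [i'], only few
    triples ([B2]) lie in [Bx i' :|: By i'] for many [i']. Thus [i'] plays two
    parts: its neighbourhood localizes the degree condition, and [i'] is itself
    the middle vertex of the detours that this condition provides. *)
Lemma most_triples_have_many_detours (I : finType) (H : {set I * I * I})
    (m : nat) :
  linear_triples H -> 0 < m ->
  exists G : {set I * I * I},
    [/\ G \subset H, m * #|H :\: G| <= 2 * #|I| ^ 2 &
        forall t, t \in G -> #|I| ^ 3 <= 32 * m ^ 5 * #|detours H t|].
Proof.
move=> [lin12 lin13 lin23] m_gt0.
(* This [q] makes the bound [4 * m * n ^ 2 / q] on [#|B2|] equal to that on
   [#|B1|]. *)
pose n := #|I|; pose q := 4 * m ^ 2.
have adj13I i j k : (i, j, k) \in H -> adj13 H i k by move=> h; apply/existsP; exists j.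
have adj23I i j k : (i, j, k) \in H -> adj23 H j k by move=> h; apply/existsP; exists i.
pose dz k := #|[set i | adj13 H i k]|.
pose dx i' i := #|[set k | adj13 H i' k && adj13 H i k]|.
pose dy i' j := #|[set k | adj13 H i' k && adj23 H j k]|.
pose B1 := [set t in H | m * dz t.2 < n].
pose Bx i' := [set t in H | adj13 H i' t.2 && (q * dx i' t.1.1 < n)].
pose By i' := [set t in H | adj13 H i' t.2 && (q * dy i' t.1.2 < n)].
have card_B1 : m * #|B1| <= n * n.
  apply: (card_low_degree (p := fun t => t.2) (r := fun t => t.1.1)
    (N := fun k => [set i | adj13 H i k])).
    move=> t t'; rewrite !inE => /andP[tH _] /andP[tH' _] [ek ei].
    by apply: lin13 => //=; rewrite ek ei.
  by move=> [[i j] k]; rewrite !inE /= => /andP[/adj13I-> ->].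
have card_Bx i' : q * #|Bx i'| <= n * n.
  apply: (card_low_degree (p := fun t => t.1.1) (r := fun t => t.2)
    (N := fun i => [set k | adj13 H i' k && adj13 H i k])).
    move=> t t'; rewrite !inE => /andP[tH _] /andP[tH' _] [ei ek].
    by apply: lin13 => //=; rewrite ek ei.
  by move=> [[i j] k]; rewrite !inE /= => /and3P[/adj13I-> -> ->].
have card_By i' : q * #|By i'| <= n * n.
  apply: (card_low_degree (p := fun t => t.1.2) (r := fun t => t.2)
    (N := fun j => [set k | adj13 H i' k && adj23 H j k])).
    move=> t t'; rewrite !inE => /andP[tH _] /andP[tH' _] [ej ek].
    by apply: lin23 => //=; rewrite ek ej.
  by move=> [[i j] k]; rewrite !inE /= => /and3P[/adj23I-> -> ->].
pose bad t := [set i' | (t \in Bx i') || (t \in By i')].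
pose B2 := [set t in H | n <= 2 * m * #|bad t|].
have sum_bad : \sum_t #|bad t| <= \sum_i' (#|Bx i'| + #|By i'|).
  rewrite (eq_bigr (fun t => \sum_i' ((t \in Bx i') || (t \in By i') : nat))); last first.
    by move=> t _; rewrite -sum1dep_card big_mkcond.
  rewrite exchange_big /=; apply: leq_sum => i' _.
  rewrite -!sum1_card [X in _ <= X + _]big_mkcond [X in _ <= _ + X]big_mkcond /=.
  rewrite -big_split /=; apply: leq_sum => t _.
  by case: (t \in Bx i'); case: (t \in By i').
have card_B2 : m * #|B2| <= n * n.
  have [n0|n_gt0] := posnP n.
    have -> : B2 = set0; last by rewrite cards0 muln0.
    by apply/setP => t; move: (card0_eq n0 t.2); rewrite inE.
  have h1 : n * #|B2| <= 2 * m * \sum_t #|bad t|.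
    rewrite mulnC -sum_nat_const big_distrr /= big_mkcond /=.
    by apply: leq_sum => t _; rewrite inE; case: ifP => // /andP[].
  have h2 : q * \sum_i' (#|Bx i'| + #|By i'|) <= n * (2 * (n * n)).
    rewrite big_distrr /= -[X in _ <= X]sum_nat_const; apply: leq_sum => i' _.
    by rewrite mulnDr mulSn mul1n leq_add.
  rewrite -(leq_pmul2l n_gt0) -(leq_pmul2l (_ : 0 < 4 * m)); last by rewrite muln_gt0.
  have : q * (n * #|B2|) <= q * (2 * m * \sum_i' (#|Bx i'| + #|By i'|)).
    by rewrite leq_mul2l (leq_trans h1) ?orbT // leq_mul2l sum_bad orbT.
  have := leq_mul (leqnn (2 * m)) h2.
  by rewrite /q expnS expn1; lia.
exists (H :\: (B1 :|: B2)); split; first exact: subsetDl.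
  have : H :\: (H :\: (B1 :|: B2)) \subset B1 :|: B2.
    by rewrite setDDr setDv set0U subsetIr.
  move/subset_leq_card => h; have := leq_trans h (leq_card_setU B1 B2).
  by rewrite -/n; move: card_B1 card_B2; clear; nia.
move=> [[i j] k]; rewrite !inE => /andP[]; rewrite negb_or => /andP[nB1 nB2] tH.
rewrite tH /= in nB1 nB2; rewrite -leqNgt in nB1; rewrite -ltnNge in nB2.
rewrite card_detours /= -/n.
pose good := [set i' | adj13 H i' k] :\: bad (i, j, k).
have card_good : n <= 2 * m * #|good|.
  have := cardsD [set i' | adj13 H i' k] (bad (i, j, k)).
  have := subset_leq_card (subsetIr [set i' | adj13 H i' k] (bad (i, j, k))).
  rewrite -/good; move: nB1 nB2; rewrite /dz; clear; nia.
have low : n ^ 2 * #|good| <= q * q * \sum_i' dy i' j * dx i' i.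
  rewrite mulnC -sum_nat_const big_distrr big_mkcond /=; apply: leq_sum => i' _.
  case: ifP => //; rewrite !inE tH /= => /andP[+ adj]; rewrite adj /= negb_or -!leqNgt.
  by move=> /andP[hx hy]; have := leq_mul hx hy; rewrite expnS expn1; lia.
rewrite [n ^ 3]expnS.
move: low; rewrite -/n; set s := \sum_i' _; rewrite /q => low.
apply: leq_trans (leq_mul card_good (leqnn _)) _.
have : 2 * m * (n ^ 2 * #|good|) <= 2 * m * (4 * m ^ 2 * (4 * m ^ 2) * s) by rewrite leq_mul2l low orbT.
by rewrite !expnS expn0; lia.
Qed.

(** * Differences along the edges of a graph with few sums *)

(** The fibres of [phi] over distinct values are disjoint. *)
Lemma uniq_popular_values (T : finType) (V : eqType) (phi : T -> V) (s : seq V)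
    (a : nat) :
  uniq s -> (forall d, d \in s -> a <= #|[set u | phi u == d]|) ->
  a * size s <= #|T|.
Proof.
move=> s_uniq popular.
apply: (@leq_trans (\sum_(d <- s) #|[set u | phi u == d]|)).
  rewrite -sum1_size big_distrr /= muln1 !big_seq.
  exact: leq_sum.
rewrite (eq_bigr (fun d => \sum_u (phi u == d : nat))); last first.
  by move=> d _; rewrite -sum1dep_card big_mkcond.
rewrite exchange_big /= -sum1_card; apply: leq_sum => u _.
have -> : \sum_(d <- s) (phi u == d : nat) = count_mem (phi u) s.
  by rewrite -sum1_count [RHS]big_mkcond; apply: eq_bigr => d _; rewrite /= eq_sym.
by rewrite count_uniq_mem // leq_b1.
Qed.

Local Open Scope fset_scope.
Local Open Scope ring_scope.

(** The graph version of passing from a small sumset to a small difference set.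
    A detour of the triple of [x] and [y] consists of triples of [H] with
    [x1 + y = z1], [x' + y4 = z1], [x' + y3 = z2] and [x + y2 = z2], so
    [x - y = x1 - y2 + y3 - y4]. By linearity distinct detours yield distinct
    [(x1, y2, y3)]. A difference with [a * n ^ 3] detours is therefore a value
    taken [a * n ^ 3] times by an expression in four indices, and there are at
    most [n / a] of those. *)
Lemma most_sums_have_few_differences (V : zmodType) (I : finType)
    (fx fy fz : I -> V) (H : {set I * I * I}) (m : nat) :
  injective fx -> injective fy -> injective fz ->
  (forall t, t \in H -> fx t.1.1 + fy t.1.2 = fz t.2) -> (0 < m)%N ->
  exists (G : {set I * I * I}) (D : seq V),
    [/\ G \subset H, (m * #|H :\: G| <= 2 * #|I| ^ 2)%N,
        forall t, t \in G -> fx t.1.1 - fy t.1.2 \in D &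
        (size D <= 32 * m ^ 5 * #|I|)%N].
Proof.
move=> fx_inj fy_inj fz_inj sumH m_gt0.
have linH : linear_triples H.
  split=> -[[i j] k] [[i' j'] k'] /sumH/= e /sumH/= e' [].
  - by move=> ei ej; subst; congr (_, _); apply: fz_inj; rewrite -e -e'.
  - move=> ei ek; subst; congr (_, _, _); apply: fy_inj.
    by apply: (addrI (fx i')); rewrite e e'.
  - move=> ej ek; subst; congr (_, _, _); apply: fx_inj.
    by apply: (addIr (fy j')); rewrite e e'.
have [G [GH cardG detG]] := most_triples_have_many_detours linH m_gt0.
exists G, (undup [seq fx t.1.1 - fy t.1.2 | t <- enum G]); split=> //.
  by move=> t tG; rewrite mem_undup; apply/mapP; exists t; rewrite ?mem_enum.
set D := undup _.
have [I0|I_gt0] := posnP #|I|.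
  have G0 : G = set0 by apply/setP => t; move: (card0_eq I0 t.2); rewrite inE.
  by rewrite /D G0 enum_set0.
case: linH => lin12 lin13 lin23.
pose x_of (j k : I) := odflt j [pick i | (i, j, k) \in H].
pose y_of (i k : I) := odflt i [pick j | (i, j, k) \in H].
have x_ofP j k : adj23 H j k -> (x_of j k, j, k) \in H.
  by case/existsP => i ijk; rewrite /x_of; case: pickP => [//|/(_ i)]; rewrite ijk.
have y_ofP i k : adj13 H i k -> (i, y_of i k, k) \in H.
  by case/existsP => j ijk; rewrite /y_of; case: pickP => [//|/(_ j)]; rewrite ijk.
pose phi (u : I * I * (I * I)) := fx u.1.1 - fy u.1.2 + fy u.2.1 - fy u.2.2.
have popular d : d \in D -> (#|I| ^ 3 <= 32 * m ^ 5 * #|[set u | phi u == d]|)%N.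
  rewrite mem_undup => /mapP[[[i j] k]]; rewrite mem_enum => tG ->.
  apply: leq_trans (detG _ tG) _; rewrite leq_mul2l; apply/orP; right.
  pose psi (u : I * I * I) :=
    let: (i', k1, k2) := u in ((x_of j k1, y_of i k2), (y_of i' k2, y_of i' k1)).
  rewrite -(@card_in_imset _ _ psi); last first.
    move=> [[i1 k1] k2] [[i1' k1'] k2']; rewrite !inE /=.
    move=> /and4P[/y_ofP a1 /x_ofP a2 /y_ofP a3 /y_ofP a4].
    move=> /and4P[/y_ofP b1 /x_ofP b2 /y_ofP b3 /y_ofP b4] [e1 e2 e3 _].
    rewrite e1 in a2; have [->] := lin12 _ _ a2 b2 erefl.
    rewrite e2 in a4; have [ek2] := lin12 _ _ a4 b4 erefl.
    rewrite e3 ek2 in a3; have [->] := lin23 _ _ a3 b3 erefl.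
    by rewrite ek2.
  apply: subset_leq_card; apply/subsetP => _ /imsetP[[[i1 k1] k2] + ->].
  rewrite !inE /=.
  move=> /and4P[/y_ofP/sumH/= a1 /x_ofP/sumH/= a2 /y_ofP/sumH/= a3 /y_ofP/sumH/= a4].
  rewrite /phi /=; apply/eqP.
  have -> : fx (x_of j k1) = fz k1 - fy j by rewrite -a2 addrK.
  have -> : fy (y_of i1 k1) = fz k1 - fx i1 by rewrite -a1 addrC addKr.
  have -> : fy (y_of i1 k2) = fz k2 - fx i1 by rewrite -a3 addrC addKr.
  have -> : fy (y_of i k2) = fz k2 - fx i by rewrite -a4 addrC addKr.
  by rewrite !opprB -addrA subrKA -addrA subrKA addrC subrKA.
have D_uniq : uniq D by apply: undup_uniq.
(* The factor [32 * m ^ 5] is moved to the other side by giving each tuple of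
   indices that many labels. *)
have popular_labelled d : d \in D ->
    (#|I| ^ 3 <= #|[set u : 'I_(32 * m ^ 5) * _ | phi u.2 == d]|)%N.
  move=> /popular/leq_trans; apply; rewrite -[X in (X * _)%N]card_ord.
  by rewrite -cardsT -cardsX; apply/subset_leq_card/subsetP => u; rewrite !inE.
have := uniq_popular_values D_uniq popular_labelled.
rewrite !card_prod card_ord => le_size.
rewrite -(leq_pmul2l (_ : 0 < #|I| ^ 3)%N) ?expn_gt0 ?I_gt0 //.
by apply: leq_trans le_size _; rewrite !expnS expn0; lia.
Qed.

(** * Complex coordinates and side lengths *)

Import Normc.

Definition cplx (R : realType) (v : plane R) : R[i] := Complex (v 0 0) (v 0 1).

Definition plane_of (R : realType) (u : R[i]) : plane R :=
  \row_j (if j == 0 then complex.Re u else complex.Im u).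

Lemma plane_ofK (R : realType) : cancel (@plane_of R) (@cplx R).
Proof. by case=> x y; rewrite /cplx !mxE. Qed.

Lemma cplxK (R : realType) : cancel (@cplx R) (@plane_of R).
Proof.
move=> v; apply/rowP => j; rewrite mxE /=.
case: eqP => [->//|]; case: j => [[|[|j]] lt_j] //= j0.
  by case: j0; apply: val_inj.
by congr (v _ _); apply: val_inj.
Qed.

Lemma cplx_inj (R : realType) : injective (@cplx R).
Proof. exact: can_inj (@cplxK R). Qed.

Lemma edistE (R : realType) (p q : plane R) :
  edist p q = normc (cplx p - cplx q).
Proof.
rewrite /edist !big_ord_recl big_ord0 addr0 /=.
by rewrite (_ : lift ord0 ord0 = 1) //; apply: val_inj.
Qed.

Definition sqn (R : realType) (u : R[i]) : R := normc u ^+ 2.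

Lemma sqnE (R : realType) (u : R[i]) : sqn u = complex.Re u ^+ 2 + complex.Im u ^+ 2.
Proof. by case: u => x y; rewrite /sqn /= sqr_sqrtr // addr_ge0 ?sqr_ge0. Qed.

Lemma sqnM (R : realType) (u v : R[i]) : sqn (u * v) = sqn u * sqn v.
Proof. by rewrite /sqn normcM exprMn. Qed.

Lemma sqnV (R : realType) (u : R[i]) : sqn u^-1 = (sqn u)^-1.
Proof. by rewrite /sqn normcV exprVn. Qed.

Lemma sqn_gt0 (R : realType) (u : R[i]) : (0 < sqn u) = (u != 0).
Proof.
case: u => x y; rewrite sqnE /= eq_complex /=.
have [->|x0] := eqVneq x 0; last by rewrite ltr_pwDl ?exprn_even_gt0 ?sqr_ge0.
by rewrite expr0n add0r exprn_even_gt0.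
Qed.

Lemma normcB_eq0 (R : realType) (u v : R[i]) : (normc (u - v) == 0) = (u == v).
Proof.
apply/eqP/eqP => [/eq0_normc/eqP|->]; first by rewrite subr_eq0 => /eqP.
by rewrite subrr normc0.
Qed.

Lemma edist_eq0 (R : realType) (p q : plane R) : (edist p q == 0) = (p == q).
Proof. by rewrite edistE normcB_eq0 (inj_eq (@cplx_inj R)). Qed.

Lemma edist_sym (R : realType) (p q : plane R) : edist p q = edist q p.
Proof. by rewrite !edistE -normcN opprB. Qed.

Lemma edist_ge0 (R : realType) (p q : plane R) : 0 <= edist p q.
Proof. exact: sqrtr_ge0. Qed.

Lemma similarity_inj (R : realType) (f : plane R -> plane R) :
  similarity f -> injective f.
Proof.
move=> [r r0 fr] x y /eqP; rewrite -edist_eq0 fr mulf_eq0 (gt_eqF r0) edist_eq0.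
by move/eqP.
Qed.

(** The sum over ordered pairs of vertices makes this a function of the set,
    with no labelling of the vertices. For a triangle and positive [k] it is
    twice the [k]-th power sum of the squared sides, so these sums encode the
    symmetric functions of the sides. *)
Definition side_sum (R : realType) (k : nat) (A : {fset plane R}) : R :=
  \sum_(x <- A) \sum_(y <- A) (edist x y ^+ 2) ^+ k.

Lemma side_sum_similar (R : realType) (f : plane R -> plane R) (r : R) (k : nat)
    (A : {fset plane R}) :
  injective f -> (forall x y, edist (f x) (f y) = r * edist x y) ->
  side_sum k [fset f x | x in A] = (r ^+ 2) ^+ k * side_sum k A.
Proof.
move=> f_inj fr; rewrite /side_sum big_imfset /=; last by move=> ? ? _ _; exact: f_inj.
rewrite big_distrr; apply: eq_bigr => x _ /=.
rewrite big_imfset /=; last by move=> ? ? _ _ /f_inj.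
by rewrite big_distrr; apply: eq_bigr => y _ /=; rewrite fr -!exprM exprMn.
Qed.

Lemma side_sum3 (R : realType) (k : nat) (a b c : plane R) :
  a != b -> a != c -> b != c -> (0 < k)%N ->
  side_sum k [fset a; b; c] =
  2 * ((edist a b ^+ 2) ^+ k + (edist a c ^+ 2) ^+ k + (edist b c ^+ 2) ^+ k).
Proof.
move=> ab ac bc k0; rewrite /side_sum.
have sum3 (F : plane R -> R) : \sum_(x <- [fset a; b; c]) F x = F a + F b + F c.
  rewrite fsetUC big_fsetU1 /= ?inE; last by rewrite negb_or eq_sym ac eq_sym bc.
  by rewrite big_fsetU1 ?inE //= big_seq_fset1; ring.
have d0 x : (edist x x ^+ 2) ^+ k = 0.
  by rewrite (eqP (_ : edist x x == 0)) ?edist_eq0 // expr0n /= expr0n gtn_eqF.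
rewrite !sum3 !d0 (edist_sym b a) (edist_sym c a) (edist_sym c b); ring.
Qed.

(** Heron's formula: sixteen times the squared area of the triangle whose
    squared sides are [x], [y], [z]. *)
Definition heron (R : realType) (x y z : R) : R :=
  2 * (x * y + y * z + z * x) - (x ^+ 2 + y ^+ 2 + z ^+ 2).

(** The squared circumradius is [x * y * z / heron x y z]. The hypotheses on
    [tau] say that two triangles share it, and the power sums say that they are
    similar with squared ratio [rho]. Then [rho = 1]: as [heron] has degree 2
    and the product degree 3, [tau = rho ^+ 2 = rho ^+ 3]. *)
Lemma same_circumradius_ratio (R : realType) (A B C x y z rho tau : R) :
  0 < A -> 0 < B -> 0 < C -> 0 < heron A B C -> 0 < rho ->
  heron x y z = tau * heron A B C ->
  x * y * z = tau * (A * B * C) ->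
  (forall k, (0 < k)%N ->
     x ^+ k + y ^+ k + z ^+ k = rho ^+ k * (A ^+ k + B ^+ k + C ^+ k)) ->
  tau = 1.
Proof.
move=> A0 B0 C0 H0 rho0 eH eP pk.
have p1 := pk 1 erefl; have p2 := pk 2 erefl; have p3 := pk 3 erefl.
rewrite !expr1 in p1.
have heronE (u v w : R) : heron u v w = (u + v + w) ^+ 2 - 2 * (u ^+ 2 + v ^+ 2 + w ^+ 2).
  by rewrite /heron; ring.
have tauE2 : tau = rho ^+ 2.
  apply: (mulIf (lt0r_neq0 H0)); rewrite -eH !heronE p1 p2; ring.
have prodE (u v w : R) : 6 * (u * v * w) = (u + v + w) ^+ 3
     - 3 * (u + v + w) * (u ^+ 2 + v ^+ 2 + w ^+ 2) + 2 * (u ^+ 3 + v ^+ 3 + w ^+ 3).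
  by ring.
have tauE3 : tau = rho ^+ 3.
  have P0 : 6 * (A * B * C) != 0 by rewrite lt0r_neq0 // !mulr_gt0.
  apply: (mulIf P0); rewrite mulrCA -eP !prodE p1 p2 p3; ring.
have rho1 : rho = 1.
  have rho20 : rho ^+ 2 != 0 by rewrite expf_neq0 // lt0r_neq0.
  by apply: (mulfI rho20); rewrite mulr1 -exprSr -tauE3 tauE2.
by rewrite tauE2 rho1 expr1n.
Qed.

(** * The harmonic fourth vertex *)

(** Here [C], [C * p], [C * q] are the squared sides of a triangle with
    shortest side [C], and the three alternatives are the triangles that the
    harmonic fourth vertex forms with each of its sides. All four have the same
    circumcircle, so a similar triangle would be congruent, and the factor
    [tau] of [same_circumradius_ratio] would be 1. In the three cases [tau] is
    the square of [1 / mu], [2 * p / mu] and [2 * q / mu], which leaves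
    [p + q = 1], [q = 1 / 2] or [p = 1 / 2]; none is possible when [p] and [q]
    are at least 1. *)
Lemma harmonic_triangles_not_similar (R : realType) (C p q rho x y z : R) :
  0 < C -> 1 <= p -> 1 <= q -> 0 < heron 1 p q -> 0 < rho ->
  (forall k, (0 < k)%N -> x ^+ k + y ^+ k + z ^+ k =
     rho ^+ k * (C ^+ k + (C * p) ^+ k + (C * q) ^+ k)) ->
  let mu := 2 * p + 2 * q - 1 in
  ~ [\/ [/\ x = C, y = C * p / mu & z = C * q / mu],
        [/\ x = C * p, y = C * p / mu & z = 4 * C * p * q / mu] |
        [/\ x = C * q, y = C * q / mu & z = 4 * C * p * q / mu]].
Proof.
move=> C0 p1 q1 H0 rho0 pk mu.
have mu0 : 0 < mu by rewrite /mu; lra.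
have mu_neq0 := lt0r_neq0 mu0.
have p0 : 0 < p by lra.
have q0 : 0 < q by lra.
have HC : 0 < heron C (C * p) (C * q).
  rewrite (_ : heron _ _ _ = C ^+ 2 * heron 1 p q); last by rewrite /heron; ring.
  by rewrite mulr_gt0 ?exprn_gt0.
have tau1 tau e1 e2 := @same_circumradius_ratio _ C (C * p) (C * q) x y z rho tau
  C0 (mulr_gt0 C0 p0) (mulr_gt0 C0 q0) HC rho0 e1 e2 pk.
have sqr_ratio t : 0 < t -> (t / mu) ^+ 2 = 1 -> t = mu.
  move=> t0 /eqP; rewrite sqrp_eq1 ?divr_ge0 ?ltW // => /eqP t1.
  by rewrite -[t](divfK mu_neq0) t1 mul1r.
case=> -[ex ey ez]; subst x y z.
- have : 1 = mu by apply: sqr_ratio => //; apply: tau1; rewrite /heron /mu; field.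
  by rewrite /mu; lra.
- have : 2 * p = mu.
    by apply: sqr_ratio; [lra | apply: tau1; rewrite /heron /mu; field].
  by rewrite /mu; lra.
- have : 2 * q = mu.
    by apply: sqr_ratio; [lra | apply: tau1; rewrite /heron /mu; field].
  by rewrite /mu; lra.
Qed.

(** The harmonic conjugate of [u + zeta * (v - u)] with respect to [u] and [v];
    for non-real [zeta] it lies on the circumcircle of these three points. *)
Definition fourth (R : realType) (zeta u v : R[i]) : R[i] :=
  ((1 - zeta) * u - zeta * v) / (1 - 2 * zeta).

Lemma nonreal_neq0 (R : realType) (zeta : R[i]) : complex.Im zeta != 0 ->
  [/\ zeta != 0, 1 - zeta != 0 & 1 - 2 * zeta != 0].
Proof.
case: zeta => x y /= y0.
have y20 : 2 * y != 0 by rewrite mulf_neq0 // pnatr_eq0.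
rewrite mulr_natl mulr2n; split; apply: contra y0; rewrite eq_complex /=.
- by case/andP.
- by rewrite sub0r oppr_eq0 => /andP[].
- move=> /andP[_].
  by rewrite sub0r oppr_eq0 -mulr2n mulrn_eq0.
Qed.

Lemma sqn_parallelogram (R : realType) (zeta : R[i]) :
  sqn (1 - 2 * zeta) = 2 * sqn zeta + 2 * sqn (1 - zeta) - 1.
Proof. by case: zeta => x y; rewrite mulr_natl mulr2n !sqnE /=; ring. Qed.

Lemma heron_sqn (R : realType) (zeta : R[i]) :
  heron 1 (sqn zeta) (sqn (1 - zeta)) = 4 * complex.Im zeta ^+ 2.
Proof. by case: zeta => x y; rewrite !sqnE /heron /=; ring. Qed.

Lemma sqn_natr (R : realType) n : sqn (n%:R : R[i]) = n%:R ^+ 2.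
Proof.
by rewrite -(rmorph_nat (real_complex R) n) sqnE /= expr0n addr0.
Qed.

Lemma sqn_eq0 (R : realType) (u : R[i]) : (sqn u == 0) = (u == 0).
Proof.
by apply/idP/idP => [|/eqP->]; [rewrite -[u == 0]negbK -sqn_gt0 => /eqP->; rewrite ltxx
  | rewrite /sqn normc0 expr0n].
Qed.

Lemma sqn_sym (R : realType) (u v : R[i]) : sqn (u - v) = sqn (v - u).
Proof. by rewrite /sqn -normcN opprB. Qed.

Lemma sqn_edist (R : realType) (p q : plane R) :
  edist p q ^+ 2 = sqn (cplx q - cplx p).
Proof. by rewrite edistE sqn_sym. Qed.

(** By the parallelogram law, [mu] is the squared modulus of the denominator
    [1 - 2 * zeta] of [fourth]. *)
Lemma fourth_distances (R : realType) (zeta u v : R[i]) :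
  complex.Im zeta != 0 ->
  let mu := 2 * sqn zeta + 2 * sqn (1 - zeta) - 1 in
  let w := fourth zeta u v in
  [/\ sqn (w - u) = sqn (v - u) * sqn zeta / mu,
      sqn (w - v) = sqn (v - u) * sqn (1 - zeta) / mu &
      sqn (w - (u + zeta * (v - u))) =
        4 * sqn (v - u) * sqn zeta * sqn (1 - zeta) / mu].
Proof.
move=> /nonreal_neq0[z0 z1 z2] mu w; rewrite /mu -sqn_parallelogram -sqnV.
split.
- have -> : w - u = - 1%:R * (v - u) * zeta * (1 - 2 * zeta)^-1 by rewrite /w /fourth; field.
  by rewrite !sqnM /sqn normcN normc1; ring.
- have -> : w - v = - 1%:R * (v - u) * (1 - zeta) * (1 - 2 * zeta)^-1.
    by rewrite /w /fourth; field.
  by rewrite !sqnM /sqn normcN normc1; ring.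
- have -> : w - (u + zeta * (v - u)) =
     - 2%:R * (v - u) * zeta * (1 - zeta) * (1 - 2 * zeta)^-1.
    by rewrite /w /fourth; field.
  by rewrite !sqnM /sqn normcN -/(sqn _) sqn_natr; ring.
Qed.

Lemma fourth_edist (R : realType) (a b z : plane R) (zeta : R[i]) :
  let w := plane_of (fourth zeta (cplx a) (cplx b)) in
  let C := edist a b ^+ 2 in
  let mu := 2 * sqn zeta + 2 * sqn (1 - zeta) - 1 in
  cplx z = cplx a + zeta * (cplx b - cplx a) -> complex.Im zeta != 0 ->
  [/\ edist a z ^+ 2 = C * sqn zeta, edist b z ^+ 2 = C * sqn (1 - zeta),
      edist a w ^+ 2 = C * sqn zeta / mu, edist b w ^+ 2 = C * sqn (1 - zeta) / mu &
      edist z w ^+ 2 = 4 * C * sqn zeta * sqn (1 - zeta) / mu].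
Proof.
move=> w C mu zE im0; rewrite /C !sqn_edist /w plane_ofK zE.
have [-> -> ->] := fourth_distances (cplx a) (cplx b) im0.
split=> //; rewrite mulrC.
  by rewrite -sqnM addrC addKr.
rewrite sqn_sym -sqnM; congr sqn; ring.
Qed.

Lemma fourth_neq (R : realType) (a b z : plane R) (zeta : R[i]) :
  let w := plane_of (fourth zeta (cplx a) (cplx b)) in
  a != b -> cplx z = cplx a + zeta * (cplx b - cplx a) -> complex.Im zeta != 0 ->
  [/\ a != z, b != z, a != w, b != w & z != w].
Proof.
move=> w ab zE im0.
have [z0 z1 z2] := nonreal_neq0 im0.
have C0 : edist a b ^+ 2 != 0 by rewrite expf_neq0 // edist_eq0.
have mu0 : 2 * sqn zeta + 2 * sqn (1 - zeta) - 1 != 0 :> R.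
  by rewrite -sqn_parallelogram sqn_eq0.
have neq (p q : plane R) (e : R) : edist p q ^+ 2 = e -> e != 0 -> p != q.
  by move=> <-; rewrite sqrf_eq0 edist_eq0.
have [eaz ebz eaw ebw ezw] := fourth_edist zE im0.
have s0 : sqn zeta != 0 by rewrite sqn_eq0.
have s1 : sqn (1 - zeta) != 0 by rewrite sqn_eq0.
have i0 := invr_neq0 mu0.
have four0 : 4 * edist a b ^+ 2 != 0 by rewrite (mulf_neq0 _ C0) // pnatr_eq0.
have az := neq _ _ _ eaz (mulf_neq0 C0 s0).
have bz := neq _ _ _ ebz (mulf_neq0 C0 s1).
have aw := neq _ _ _ eaw (mulf_neq0 (mulf_neq0 C0 s0) i0).
have bw := neq _ _ _ ebw (mulf_neq0 (mulf_neq0 C0 s1) i0).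
have zw := neq _ _ _ ezw (mulf_neq0 (mulf_neq0 (mulf_neq0 four0 s0) s1) i0).
by split.
Qed.

Lemma cardfs3_le (K : choiceType) (a b c : K) : (#|` [fset a; b; c]| <= 3)%N.
Proof. by rewrite fsetUC cardfsU1 cardfs2; case: (_ \notin _); case: (_ != _). Qed.

Lemma cardfs4 (K : choiceType) (a b c d : K) :
  a != b -> [/\ a != c, b != c, a != d, b != d & c != d] ->
  #|` [fset a; b; c]| = 3%N /\ #|` [fset a; b; c; d]| = 4%N.
Proof.
move=> ab [ac bc ad bd cd].
have card3 : #|` [fset a; b; c]| = 3%N.
  by rewrite fsetUC cardfsU1 cardfs2 !inE ab !(eq_sym c) (negbTE ac) (negbTE bc).
split=> //; rewrite fsetUC cardfsU1 card3 !inE.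
by rewrite !(eq_sym d) (negbTE ad) (negbTE bd) (negbTE cd).
Qed.

Lemma three_of_four (K : choiceType) (a b c d : K) (A : {fset K}) :
  #|` [fset a; b; c; d]| = 4%N -> A `<=` [fset a; b; c; d] -> #|` A| = 3%N ->
  [\/ A = [fset a; b; c], A = [fset a; b; d], A = [fset a; c; d] |
      A = [fset b; c; d]].
Proof.
move=> Q4 AQ A3.
have eqA x y z : (forall t, t \in A -> t \in [fset x; y; z]) -> A = [fset x; y; z].
  move=> sub; apply/eqP; rewrite eqEfcard A3 cardfs3_le andbT.
  exact/fsubsetP.
have inQ t : t \in A -> [|| t == a, t == b, t == c | t == d].
  by move=> /(fsubsetP AQ); rewrite !inE -!orbA.
have mem v t : v \notin A -> t \in A -> (t == v) = false.
  by move=> vA tA; apply: contraNF vA => /eqP<-.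
have [dA|dA] := boolP (d \in A); last first.
  constructor 1; apply: eqA => t tA; have := inQ t tA.
  by rewrite (mem d) // orbF !inE -orbA.
have [cA|cA] := boolP (c \in A); last first.
  constructor 2; apply: eqA => t tA; have := inQ t tA.
  by rewrite (mem c) // !inE -orbA.
have [bA|bA] := boolP (b \in A); last first.
  constructor 3; apply: eqA => t tA; have := inQ t tA.
  by rewrite (mem b) // !inE -orbA.
have [aA|aA] := boolP (a \in A); last first.
  constructor 4; apply: eqA => t tA; have := inQ t tA.
  by rewrite (mem a) // !inE -orbA.
have : [fset a; b; c; d] `<=` A.
  by apply/fsubsetP => t; rewrite !inE => /orP[/orP[/orP[]|]|] /eqP->.
by move/fsubset_leq_card; rewrite Q4 A3.
Qed.

(** Besides the copy of [[fset a; b; z]] itself, a copy of the quadrangle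
    contains three triangles, one on each side of [[fset a; b; z]]. None of
    them is similar to it when [a] and [b] span its shortest side; for other
    sides this can fail, as for the right angle of a right triangle, whose
    harmonic conjugate is its mirror image. *)
Lemma unique_copy_in_quadrangle (R : realType) (a b z : plane R) (zeta : R[i])
    (f : plane R -> plane R) (A : {fset plane R}) :
  let w := plane_of (fourth zeta (cplx a) (cplx b)) in
  a != b -> cplx z = cplx a + zeta * (cplx b - cplx a) ->
  complex.Im zeta != 0 -> edist a b <= edist a z -> edist a b <= edist b z ->
  similarity f -> fset_similar [fset a; b; z] A ->
  A `<=` [fset f x | x in [fset a; b; z; w]] ->
  A = [fset f x | x in [fset a; b; z]].
Proof.
move=> w ab zE im0 le_az le_bz f_sim [g g_sim AE] Asub.
have f_inj := similarity_inj f_sim; have g_inj := similarity_inj g_sim.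
have [A0 A0Q fA0] : exists2 A0, A0 `<=` [fset a; b; z; w] & A = [fset f x | x in A0].
  exists [fset x in [fset a; b; z; w] | f x \in A].
    by apply/fsubsetP => x; rewrite !inE => /andP[].
  apply/fsetP => y; apply/idP/imfsetP => [yA|[x + ->]]; last first.
    by rewrite !inE => /andP[].
  have /imfsetP[x xQ yx] := fsubsetP Asub y yA.
  by exists x => //; rewrite !inE -yx yA andbT; rewrite !inE in xQ.
have [C3 Q4] := cardfs4 ab (fourth_neq ab zE im0); rewrite -/w in Q4.
have cardA0 : #|` A0| = 3%N.
  transitivity #|` A|; first by rewrite fA0 (card_imfset _ _ f_inj).
  by rewrite AE (card_imfset _ _ g_inj) C3.
have [az bz aw bw zw] := fourth_neq ab zE im0; rewrite -/w in aw bw zw.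
have [eaz ebz eaw ebw ezw] := fourth_edist zE im0; rewrite -/w in eaw ebw ezw.
case: f_sim => rf rf0 fr; case: g_sim => rg rg0 gr.
pose rho := (rg / rf) ^+ 2.
have rho0 : 0 < rho by rewrite exprn_gt0 ?divr_gt0.
have sums k : (0 < k)%N -> side_sum k A0 = rho ^+ k * side_sum k [fset a; b; z].
  move=> k0; have := side_sum_similar k [fset a; b; z] g_inj gr.
  rewrite -AE fA0 (side_sum_similar k A0 f_inj fr) => e.
  have rfk : (rf ^+ 2) ^+ k != 0 by rewrite !expf_neq0 ?gt_eqF.
  by apply: (mulfI rfk); rewrite e mulrA -exprMn -exprMn mulrCA divff ?mulr1 ?gt_eqF.
have C0 : 0 < edist a b ^+ 2 by rewrite exprn_gt0 // lt_def edist_eq0 ab edist_ge0.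
have p1 : 1 <= sqn zeta.
  by rewrite -(ler_pM2l C0) mulr1 -eaz lerXn2r // nnegrE edist_ge0.
have q1 : 1 <= sqn (1 - zeta).
  by rewrite -(ler_pM2l C0) mulr1 -ebz lerXn2r // nnegrE edist_ge0.
have H0 : 0 < heron 1 (sqn zeta) (sqn (1 - zeta)).
  by rewrite heron_sqn mulr_gt0 ?ltr0n // exprn_even_gt0.
have excl x y t := @harmonic_triangles_not_similar _ _ _ _ _ x y t C0 p1 q1 H0 rho0.
have {}sums x y t : x != y -> x != t -> y != t -> A0 = [fset x; y; t] ->
  forall k, (0 < k)%N ->
   (edist x y ^+ 2) ^+ k + (edist x t ^+ 2) ^+ k + (edist y t ^+ 2) ^+ k =
   rho ^+ k * ((edist a b ^+ 2) ^+ k + (edist a b ^+ 2 * sqn zeta) ^+ k +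
     (edist a b ^+ 2 * sqn (1 - zeta)) ^+ k).
  move=> xy xt yt A0E k k0; have two0 : 2 != 0 :> R by rewrite pnatr_eq0.
  apply: (mulfI two0); rewrite -side_sum3 // -A0E sums // side_sum3 //.
  by rewrite eaz ebz mulrCA.
case: (three_of_four Q4 A0Q cardA0) => A0E.
- by rewrite fA0 A0E.
- by case: (excl _ _ _ (sums _ _ _ ab aw bw A0E)); constructor 1.
- by case: (excl _ _ _ (sums _ _ _ az aw zw A0E)); constructor 2.
- by case: (excl _ _ _ (sums _ _ _ bz bw zw A0E)); constructor 3.
Qed.

(** * Similarities *)

Lemma triangle_shortest_side (R : realType) (T : {fset plane R}) :
  triangle T -> exists a b z,
    [/\ T = [fset a; b; z], a != b, edist a b <= edist a z & edist a b <= edist b z].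
Proof.
case=> T3 _.
have [a [b [c [ET ab ac bc]]]] : exists a b c,
    [/\ T = [fset a; b; c], a != b, a != c & b != c].
  case ET : (enum_fset T) T3 (fset_uniq T) => [|a [|b [|c []]]] //= _.
  rewrite !inE negb_or andbT => /andP[/andP[ab ac] bc].
  exists a, b, c; split=> //; apply/fsetP => x.
  by rewrite -[x \in T]/(x \in enum_fset T) ET !inE orbA.
rewrite {}ET.
have [le1|/ltW le1] := leP (edist a b) (edist a c).
  have [le2|/ltW le2] := leP (edist a b) (edist b c); first by exists a, b, c.
  exists b, c, a; split=> //; last by rewrite (edist_sym c) (le_trans le2).
    by apply/fsetP => x; rewrite !inE; case: (x == a); case: (x == b); case: (x == c).
  by rewrite (edist_sym b a).
have [le2|/ltW le2] := leP (edist a c) (edist b c).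
  exists a, c, b; split=> //; last by rewrite (edist_sym c).
  by apply/fsetP => x; rewrite !inE; case: (x == a); case: (x == b); case: (x == c).
exists b, c, a; split=> //; last by rewrite (edist_sym c).
  by apply/fsetP => x; rewrite !inE; case: (x == a); case: (x == b); case: (x == c).
by rewrite (edist_sym b a) (le_trans le2).
Qed.

Lemma triangle_im_ratio_neq0 (R : realType) (a b z : plane R) (zeta : R[i]) :
  triangle [fset a; b; z] -> a != b ->
  cplx z = cplx a + zeta * (cplx b - cplx a) -> complex.Im zeta != 0.
Proof.
move=> [_ not_coll] ab zE; apply/eqP => im0; apply: not_coll.
exists a, (b - a); split=> [/eqP|x]; first by rewrite subr_eq0 eq_sym (negbTE ab).
rewrite !inE => /orP[/orP[]|] /eqP->.
- by exists 0; rewrite scale0r addr0.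
- by exists 1; rewrite scale1r addrC subrK.
- exists (complex.Re zeta); apply: cplx_inj; rewrite zE.
  case: zeta im0 {zE} => t u /= ->.
  by rewrite /cplx !mxE /GRing.add /GRing.mul /GRing.opp /= !mul0r subr0 addr0.
Qed.

(** Similarities of the plane are the maps [u |-> p + q * mirror s u] with
    [q != 0]; [s] is set for those that reverse orientation. *)
Definition mirror (R : realType) (s : bool) (u : R[i]) : R[i] :=
  if s then conjc u else u.

Lemma mirrorB (R : realType) s (u v : R[i]) :
  mirror s (u - v) = mirror s u - mirror s v.
Proof. by case: s => //=; rewrite rmorphB. Qed.

Lemma normc_mirror (R : realType) s (u : R[i]) : normc (mirror s u) = normc u.
Proof. by case: s u => -[x y] //=; rewrite sqrrN. Qed.

(** Two circles meet in at most two points, here conjugate because the centres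
    0 and 1 are real. *)
Lemma eq_mirror (R : realType) (u v : R[i]) :
  sqn u = sqn v -> sqn (1 - u) = sqn (1 - v) -> exists s, u = mirror s v.
Proof.
case: u v => x y [x' y']; rewrite !sqnE /= => e1 e2.
have ex : x = x' by lra.
have : (y - y') * (y + y') = 0 by rewrite ex in e1; rewrite -subr_sqr; lra.
move/eqP; rewrite mulf_eq0 subr_eq0 addr_eq0 => /orP[]/eqP->; rewrite ex.
  by exists false.
by exists true.
Qed.

Lemma similarity_ratio (R : realType) (f : plane R -> plane R) (a b z : plane R)
    (zeta : R[i]) :
  similarity f -> a != b -> cplx z = cplx a + zeta * (cplx b - cplx a) ->
  exists s, cplx (f z) = cplx (f a) + mirror s zeta * (cplx (f b) - cplx (f a)).
Proof.
move=> f_sim ab zE.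
have fab : cplx (f b) - cplx (f a) != 0.
  by rewrite subr_eq0 !inj_eq //; [rewrite eq_sym|exact: similarity_inj|exact: cplx_inj].
have ba0 : cplx b - cplx a != 0.
  by rewrite subr_eq0 eq_sym inj_eq //; exact: cplx_inj.
case: f_sim => r r0 fr.
have sq p q : sqn (cplx (f q) - cplx (f p)) = r ^+ 2 * sqn (cplx q - cplx p).
  by rewrite -!sqn_edist fr exprMn.
pose xi := (cplx (f z) - cplx (f a)) / (cplx (f b) - cplx (f a)).
have [s xiE] : exists s, xi = mirror s zeta.
  have n0 : sqn (cplx b - cplx a) != 0 by rewrite sqn_eq0.
  apply: eq_mirror.
    rewrite /xi sqnM sqnV !sq zE addrC addKr sqnM; field.
    by rewrite n0 gt_eqF.
  have -> : 1 - xi = (cplx (f b) - cplx (f z)) / (cplx (f b) - cplx (f a)).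
    by rewrite /xi; field.
  rewrite sqnM sqnV !sq zE.
  have -> : cplx b - (cplx a + zeta * (cplx b - cplx a)) =
     (1 - zeta) * (cplx b - cplx a) by ring.
  rewrite sqnM; field.
  by rewrite n0 gt_eqF.
by exists s; rewrite -xiE /xi divfK // addrC subrK.
Qed.

(** A similarity of given orientation is determined by the images [a'] and [b']
    of two distinct points [a] and [b]. *)
Definition simil (R : realType) (s : bool) (a b a' b' p : plane R) : plane R :=
  plane_of (cplx a' + mirror s ((cplx p - cplx a) / (cplx b - cplx a))
                      * (cplx b' - cplx a')).

Lemma similP (R : realType) (s : bool) (a b a' b' : plane R) :
  a != b -> a' != b' -> similarity (simil s a b a' b').
Proof.
move=> ab ab'; exists (edist a' b' / edist a b).
  by rewrite divr_gt0 // lt_def edist_eq0 ?ab ?ab' edist_ge0.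
move=> p q; rewrite !edistE !plane_ofK.
have -> (u v w x : R[i]) : u + v * w - (u + x * w) = (v - x) * w by ring.
rewrite -mirrorB normcM normc_mirror -mulrBl.
have -> : cplx p - cplx a - (cplx q - cplx a) = cplx p - cplx q by ring.
rewrite normcM normcV -(normcN (cplx b - _)) -(normcN (cplx b' - _)) !opprB; ring.
Qed.

Lemma simil_left (R : realType) (s : bool) (a b a' b' : plane R) :
  simil s a b a' b' a = a'.
Proof.
rewrite /simil subrr mul0r (_ : mirror s 0 = 0) ?mul0r ?addr0 ?cplxK //.
by case: s => //; exact: conjc0.
Qed.

Lemma simil_ratio (R : realType) (s : bool) (a b a' b' p : plane R) (zeta : R[i]) :
  a != b -> cplx p = cplx a + zeta * (cplx b - cplx a) ->
  simil s a b a' b' p = plane_of (cplx a' + mirror s zeta * (cplx b' - cplx a')).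
Proof.
move=> ab pE; rewrite /simil pE addrAC subrr add0r mulfK //.
by rewrite subr_eq0 eq_sym inj_eq //; exact: cplx_inj.
Qed.

Lemma simil_right (R : realType) (s : bool) (a b a' b' : plane R) :
  a != b -> simil s a b a' b' b = b'.
Proof.
move=> ab; rewrite (@simil_ratio _ s a b a' b' b 1) //; last by rewrite mul1r addrC subrK.
have -> : mirror s 1 = 1 :> R[i] by case: s => //; exact: conjc1.
by rewrite mul1r [_ + (_ - _)]addrC subrK cplxK.
Qed.

Lemma mirror_im_neq0 (R : realType) s (zeta : R[i]) :
  complex.Im zeta != 0 -> complex.Im (mirror s zeta) != 0.
Proof. by case: s zeta => -[x y] //=; rewrite oppr_eq0. Qed.

Lemma simil_fourth (R : realType) (s : bool) (a b a' b' : plane R) (zeta : R[i]) :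
  a != b -> complex.Im zeta != 0 ->
  simil s a b a' b' (plane_of (fourth zeta (cplx a) (cplx b))) =
  plane_of (fourth (mirror s zeta) (cplx a') (cplx b')).
Proof.
move=> ab im0.
have fourthE (xi u v : R[i]) : complex.Im xi != 0 ->
    fourth xi u v = u + - xi / (1 - 2 * xi) * (v - u).
  by move=> /nonreal_neq0[_ _ n2]; rewrite /fourth; field.
rewrite (@simil_ratio _ s a b a' b' _ (- zeta / (1 - 2 * zeta))) //; last first.
  by rewrite plane_ofK fourthE.
rewrite fourthE ?mirror_im_neq0 //; congr (plane_of (_ + _ * _)).
case: (s) => //=.
by rewrite rmorphM rmorphN fmorphV rmorphB rmorphM rmorph1 rmorph_nat.
Qed.

(** * Counting copies *)

(** The triples that are directly similar to the triangle 0, 1, [xi]. *)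
Definition copy_triples (R : realType) (xi : R[i]) (S : {fset plane R}) :
    {set S * S * S} :=
  [set t : S * S * S | (val t.1.1 != val t.1.2) &&
     (cplx (val t.2) == cplx (val t.1.1) + xi * (cplx (val t.1.2) - cplx (val t.1.1)))].

Definition vertices (R : realType) (S : {fset plane R}) (t : S * S * S) :
  {fset plane R} := [fset val t.1.1; val t.1.2; val t.2].

(** The third point of a triple is [(1 - xi) * u + xi * v] and its fourth
    vertex is, up to a constant factor, [(1 - xi) * u - xi * v]: sums along the
    triples stay in [S], so their differences are few. *)
Lemma few_fourth_vertices (R : realType) (xi : R[i]) (S : {fset plane R}) (m : nat) :
  complex.Im xi != 0 -> (0 < m)%N ->
  exists (G : {set S * S * S}) (E : {fset plane R}),
    [/\ G \subset copy_triples xi S,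
        (m * #|copy_triples xi S :\: G| <= 2 * #|` S| ^ 2)%N,
        (#|` E| <= 32 * m ^ 5 * #|` S|)%N &
        forall t, t \in G ->
          plane_of (fourth xi (cplx (val t.1.1)) (cplx (val t.1.2))) \in E].
Proof.
move=> im0 m0; have [z0 z1 _] := nonreal_neq0 im0.
pose fx (i : S) := (1 - xi) * cplx (val i).
pose fy (i : S) := xi * cplx (val i).
pose fz (i : S) := cplx (val i).
have fz_inj : injective fz by move=> i j /cplx_inj/val_inj.
have fx_inj : injective fx by move=> i j /(mulfI z1)/fz_inj.
have fy_inj : injective fy by move=> i j /(mulfI z0)/fz_inj.
have sumH t : t \in copy_triples xi S -> fx t.1.1 + fy t.1.2 = fz t.2.
  by rewrite inE => /andP[_ /eqP]; rewrite /fz => ->; rewrite /fx /fy; ring.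
have [G [D [GH cardG GD cardD]]] :=
  most_sums_have_few_differences fx_inj fy_inj fz_inj sumH m0.
exists G, [fset plane_of (d / (1 - 2 * xi)) | d in D]; rewrite cardfE; split=> //.
  by apply: leq_trans cardD; rewrite (leq_trans (leq_imfset_card _ _ _)) //= size_undup.
move=> t /GD tD; apply/imfsetP; exists (fx t.1.1 - fy t.1.2) => //.
Qed.

Lemma mem_copies (R : realType) (F S A : {fset plane R}) :
  (A \in copies F S) = (A `<=` S) && `[< fset_similar F A >].
Proof. by rewrite !inE /= fpowersetE. Qed.

Lemma copy_has_triple (R : realType) (a b z : plane R) (zeta : R[i])
    (S A : {fset plane R}) :
  a != b -> cplx z = cplx a + zeta * (cplx b - cplx a) ->
  A \in copies [fset a; b; z] S ->
  exists s, exists2 t, t \in copy_triples (mirror s zeta) S & A = vertices t.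
Proof.
move=> ab zE; rewrite mem_copies => /andP[AS /asboolP[f f_sim AE]].
have [s fzE] := similarity_ratio f_sim ab zE.
have memS x : x \in [fset a; b; z] -> f x \in S.
  by move=> xT; apply: (fsubsetP AS); rewrite AE; apply/imfsetP; exists x.
have aS : f a \in S by apply: memS; rewrite !inE eqxx.
have bS : f b \in S by apply: memS; rewrite !inE eqxx orbT.
have zS : f z \in S by apply: memS; rewrite !inE eqxx !orbT.
exists s, ([` aS], [` bS], [` zS]).
  by rewrite inE /= fzE eqxx andbT inj_eq //; exact: similarity_inj.
by rewrite AE /vertices /= !imfsetU !imfset_fset1.
Qed.

Lemma triple_extends (R : realType) (a b z : plane R) (zeta : R[i])
    (S : {fset plane R}) (s : bool) (t : S * S * S) :
  let w := plane_of (fourth zeta (cplx a) (cplx b)) in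
  a != b -> cplx z = cplx a + zeta * (cplx b - cplx a) -> complex.Im zeta != 0 ->
  t \in copy_triples (mirror s zeta) S ->
  fset_similar [fset a; b; z; w]
    (vertices t `|`
     [fset plane_of (fourth (mirror s zeta) (cplx (val t.1.1)) (cplx (val t.1.2)))]).
Proof.
move=> w ab zE im0; rewrite inE => /andP[ab' /eqP tE].
exists (simil s a b (val t.1.1) (val t.1.2)); first exact: similP.
rewrite !imfsetU !imfset_fset1 simil_left simil_right // simil_fourth //.
by rewrite (simil_ratio _ _ _ ab zE) -tE cplxK.
Qed.

Theorem theorem1p5 (R : realType) (c eps : R) (hc : 0 < c) (heps : 0 < eps) :
  exists2 D : R, 0 < D &
  exists n0 : nat, forall n : nat, (n0 <= n)%N ->
  forall T S : {fset plane R},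
    triangle T ->
    #|` S| = n ->
    c * n%:R ^+ 2 <= #|` copies T S|%:R ->
  exists Q U : {fset plane R},
    [/\ quadrangle Q,
        (S `<=` U)%fset,
        #|` U|%:R <= D * n%:R &
        (c - eps) * n%:R ^+ 2 <= #|` copies Q U|%:R].
Proof.
(* For each of the two orientations, at most [2 * n ^ 2 / m] copies are lost. *)
pose m := Num.bound (4 / eps).
have m_gt : 4 / eps < m%:R by apply: archi_boundP; rewrite divr_ge0 // ltW.
have m0 : (0 < m)%N by rewrite -(ltr_nat R) (le_lt_trans _ m_gt) // divr_ge0 // ltW.
exists (1 + 64 * m ^ 5)%N%:R; first by rewrite ltr0n.
exists 0%N => n _ T S T_tri cardS many.
have [a [b [z [TE ab le_az le_bz]]]] := triangle_shortest_side T_tri.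
pose zeta := (cplx z - cplx a) / (cplx b - cplx a).
have zE : cplx z = cplx a + zeta * (cplx b - cplx a).
  rewrite /zeta divfK; first by rewrite [RHS]addrC subrK.
  by rewrite subr_eq0 eq_sym inj_eq //; exact: cplx_inj.
have im0 : complex.Im zeta != 0 by apply: triangle_im_ratio_neq0 ab zE; rewrite -TE.
pose w := plane_of (fourth zeta (cplx a) (cplx b)).
pose Q := [fset a; b; z; w].
have [_ Q4] := cardfs4 ab (fourth_neq ab zE im0).
have few s := few_fourth_vertices S (mirror_im_neq0 s im0) m0.
have [G0 [E0 [GH0 cG0 cE0 GE0]]] := few false.
have [G1 [E1 [GH1 cG1 cE1 GE1]]] := few true.
pose U := S `|` (E0 `|` E1).
pose lost s (G : {set S * S * S}) :=
  [fset vertices t | t in copy_triples (mirror s zeta) S :\: G].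
have card_lost s G : (#|` lost s G| <= #|copy_triples (mirror s zeta) S :\: G|)%N.
  by rewrite cardE; apply: leq_imfset_card.
exists Q, U; split=> //; first exact: fsubsetUl.
  rewrite -natrM ler_nat.
  apply: leq_trans (leq_card_fsetU _ _) _.
  rewrite cardS in cE0 cE1 *; rewrite mulnDl mul1n leq_add2l.
  apply: leq_trans (leq_card_fsetU _ _) _.
  by rewrite (leq_trans (leq_add cE0 cE1)) // -!mulnDl.
(* A copy [Q'] of [Q] determines the copy of [T] that it extends, so the copies
   of [T] that extend into [U] are no more numerous than the copies of [Q]. For
   such a [Q'] the set [copies T Q'] is a singleton; [fset0] is only a default
   value elsewhere. *)
pose sole (Q' : {fset plane R}) := head fset0 (enum_fset (copies T Q')).
have soleP A s t : A = vertices t -> t \in copy_triples (mirror s zeta) S ->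
    plane_of (fourth (mirror s zeta) (cplx (val t.1.1)) (cplx (val t.1.2))) \in U ->
    A \in copies T S -> A \in [fset sole Q' | Q' in copies Q U].
  move=> AE tH dU; rewrite mem_copies => /andP[AS /asboolP A_sim].
  have Q'_sim := triple_extends ab zE im0 tH; rewrite -/w -AE -/Q in Q'_sim.
  set Q' := A `|` _ in Q'_sim.
  have AQ' : A \in copies T Q'.
    by rewrite mem_copies fsubsetUl; apply/asboolP.
  apply/imfsetP; exists Q' => /=.
    rewrite mem_copies; apply/andP; split; last exact/asboolP.
    by rewrite fsubUset (fsubset_trans AS (fsubsetUl _ _)) fsub1set.
  case: Q'_sim => f f_sim Q'E.
  have uniqQ' B : B \in copies T Q' -> B = [fset f x | x in T].
    rewrite mem_copies TE Q'E => /andP[BQ' /asboolP B_sim].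
    exact: unique_copy_in_quadrangle ab zE im0 le_az le_bz f_sim B_sim BQ'.
  rewrite (uniqQ' A AQ') (uniqQ' (sole Q')) // /sole.
  move: AQ'; rewrite -[A \in _]/(A \in enum_fset (copies T Q')).
  rewrite -[_ \in copies T Q']/(_ \in enum_fset (copies T Q')).
  by case: (enum_fset _) => //= x ? _; rewrite mem_head.
have cover : copies T S `<=` (lost false G0 `|` lost true G1) `|`
     [fset sole Q' | Q' in copies Q U].
  apply/fsubsetP => A AT; have := AT; rewrite {1}TE => /(copy_has_triple ab zE).
  move=> [s [t tH AE]]; rewrite !in_fsetU.
  have [tG|tG] := boolP (t \in if s then G1 else G0).
    apply/orP; right; apply: (soleP A s t) => //.
    rewrite !in_fsetU; case: (s) tG => [/GE1|/GE0] -> //; first by rewrite !orbT.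
    by rewrite orbT.
  apply/orP; left; apply/orP; case: s tH tG => tH tG; [right|left];
    by apply/imfsetP; exists t => //=; rewrite inE tG.
have count : (#|` copies T S| <= #|copy_triples (mirror false zeta) S :\: G0| +
    #|copy_triples (mirror true zeta) S :\: G1| + #|` copies Q U|)%N.
  apply: leq_trans (fsubset_leq_card cover) _.
  apply: leq_trans (leq_card_fsetU _ _) _; apply: leq_add.
    by apply: leq_trans (leq_card_fsetU _ _) _; apply: leq_add.
  exact: leq_imfset_card.
have loss : (m * #|` copies T S| <= 4 * n ^ 2 + m * #|` copies Q U|)%N.
  rewrite cardS in cG0 cG1; apply: leq_trans (leq_mul (leqnn m) count) _.
  by rewrite !mulnDr leq_add2r (leq_trans (leq_add cG0 cG1)) // -mulnDl.
have mR0 : 0 < m%:R :> R by rewrite ltr0n.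
rewrite -(ler_pM2l mR0).
move: loss; rewrite -(ler_nat R) natrD !natrM => loss.
have := ler_wpM2l (ltW mR0) many.
have eps_m : 4 <= m%:R * eps by rewrite -ler_pdivrMr // ltW.
have := ler_wpM2r (sqr_ge0 (n%:R : R)) eps_m.
by lra.
Qed.
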